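(* Let $\kappa$ be a regular infinite cardinal and $\mu$ a singular cardinal with $\mathrm{cf}(\mu)=\kappa$. (1) (a) $\mu^{<\kappa}\le\mathrm{non}(\mathcal M_\kappa({}^{\kappa}\mu,\kappa))$; (b) $2^{<\mu}\le\mathrm{non}(\mathcal M_\kappa({}^{\mu}2,\mu))$; (c) $\mu^{<\mu}\le\min\{\mathrm{non}(\mathcal M_\kappa({}^{\mu}\mu,\mathrm{bd})),\mathrm{non}(\mathcal M_\kappa({}^{\mu}\mu,\mu))\}$. (2) (a) $\mathrm{non}(\mathcal M_\kappa({}^{\kappa}\kappa,\kappa))\le\mathrm{non}(\mathcal M_\kappa({}^{\kappa}\mu,\kappa))$; (b) $\mathrm{non}(\mathcal M_\kappa({}^{\kappa}\mu,\kappa))\le\mathrm{non}(\mathcal M_\kappa({}^{\mu}\mu,\mathrm{bd}))$; (c) $\mathrm{non}(\mathcal M_\kappa({}^{\kappa}\mu,\kappa))\le\mathrm{non}(\mathcal M_\kappa({}^{\mu}\mu,\kappa))$; (d) $\mathrm{non}(\mathcal M_\kappa({}^{\mu}2,\mu))\le\mathrm{non}(\mathcal M_\kappa({}^{\mu}\mu,\mu))$; (e) $\mathrm{non}(\mathcal M_\kappa({}^{\kappa}\kappa,\kappa))\le\mathrm{non}(\mathcal M_\kappa({}^{\mu}\kappa,\kappa))$; (f) $\mathrm{non}(\mathcal M_\kappa({}^{\mu}\kappa,\kappa))\le\mathrm{non}(\mathcal M_\kappa({}^{\mu}\mu,\kappa))$. (3) $\mathrm{cf}([\mu]^{\kappa})\le\min\{\mathrm{non}(\mathcal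 M_\kappa({}^{\kappa}\mu,\kappa)),\mathrm{non}(\mathcal M_\kappa({}^{\mu}2,\mu))\}$.
   Context: For ordinals $\delta,\rho$, ${}^{\delta}\rho$ is the set of functions $\delta\to\rho$; for a partial function $s\colon\delta\rightharpoonup\rho$, $[s]=\{f\in{}^{\delta}\rho: s\subseteq f\}$. Topologies on ${}^{\delta}\rho$: ${<}\kappa$-box (base $[s]$, $|\mathrm{dom}(s)|<\kappa$), denoted $\kappa$; ${<}\mu$-box (base $[s]$, $|\mathrm{dom}(s)|<\mu$), denoted $\mu$; bounded (base $[s]$, $s\in{}^{\alpha}\rho$, $\alpha<\delta$), denoted $\mathrm{bd}$. (On ${}^{\kappa}\mu$ the bounded and ${<}\kappa$-box topologies coincide.) A set is $\kappa$-meagre if it is a union of at most $\kappa$ nowhere dense sets; $\mathcal M_\kappa(X,\tau)$ is the ideal of $\kappa$-meagre subsets; $\mathrm{non}(\mathcal I)$ is the least size of a subset of the space not in $\mathcal I$. $\mathrm{cf}([\mu]^{\kappa})$ is the least size of a family $\mathcal F\subseteq[\mu]^{\le\kappa}$ such that every subset of $\mu$ of size $\le\kappa$ is contained in some member of $\mathcal F$. *)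

(* Defs.v *)
(* plain Prop-valued predicates; ordinals/cardinals are modelled
   as types equipped with a strict well-order. *)
From Stdlib Require Import Classical.

Set Implicit Arguments.

Definition card_le (A B : Type) : Prop :=
  exists f : A -> B, forall x y, f x = f y -> x = y.

Definition strict_well_order {T : Type} (lt : T -> T -> Prop) : Prop :=
  (forall x, ~ lt x x) /\
  (forall x y z, lt x y -> lt y z -> lt x z) /\
  (forall x y, lt x y \/ x = y \/ lt y x) /\
  well_founded lt.

Definition is_cardinal {T : Type} (lt : T -> T -> Prop) : Prop :=
  strict_well_order lt /\ forall a : T, ~ card_le T {b : T | lt b a}.

Definition infinite_type (T : Type) : Prop := card_le nat T.

Definition cofinal {T : Type} (lt : T -> T -> Prop) (S : T -> Prop) : Prop :=
  forall a, exists b, S b /\ ~ lt b a.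

Definition regular {T : Type} (lt : T -> T -> Prop) : Prop :=
  forall S, cofinal lt S -> card_le T {x : T | S x}.

Definition cf_is {T : Type} (lt : T -> T -> Prop) (K : Type) : Prop :=
  (exists S, cofinal lt S /\ card_le {x : T | S x} K) /\
  (forall S, cofinal lt S -> card_le K {x : T | S x}).

(** basic open set [s] for a partial function s with domain dom *)
Definition basic_open {D R : Type} (dom : D -> Prop) (s : D -> R)
  : (D -> R) -> Prop :=
  fun f => forall x, dom x -> f x = s x.

Definition box_base (D R Lam : Type) (U : (D -> R) -> Prop) : Prop :=
  exists (dom : D -> Prop) (s : D -> R),
    ~ card_le Lam {x : D | dom x} /\ forall f, U f <-> basic_open dom s f.

Definition bd_base (D R : Type) (ltD : D -> D -> Prop) (U : (D -> R) -> Prop)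
  : Prop :=
  exists (a : D) (s : D -> R),
    forall f, U f <-> basic_open (fun b => ltD b a) s f.

Definition open_from {X : Type} (base : (X -> Prop) -> Prop) (U : X -> Prop)
  : Prop :=
  forall x, U x -> exists B, base B /\ B x /\ forall y, B y -> U y.

Definition closure_from {X : Type} (base : (X -> Prop) -> Prop) (N : X -> Prop)
  (x : X) : Prop :=
  forall U, open_from base U -> U x -> exists y, U y /\ N y.

Definition nowhere_dense {X : Type} (base : (X -> Prop) -> Prop) (N : X -> Prop)
  : Prop :=
  forall U, open_from base U -> (forall x, U x -> closure_from base N x) ->
    forall x, ~ U x.

Definition meagre (K : Type) {X : Type} (base : (X -> Prop) -> Prop)
  (A : X -> Prop) : Prop :=
  exists Nf : K -> X -> Prop,
    (forall i, nowhere_dense base (Nf i)) /\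
    forall x, A x <-> exists i, Nf i x.

(** |T| <= non(I)   (vacuous, i.e. non(I) = infinity, if every set is in I) *)
Definition card_le_non (T : Type) {X : Type} (I : (X -> Prop) -> Prop) : Prop :=
  forall A : X -> Prop, ~ I A -> card_le T {x : X | A x}.

Definition non_le {X1 X2 : Type} (I1 : (X1 -> Prop) -> Prop)
  (I2 : (X2 -> Prop) -> Prop) : Prop :=
  forall B : X2 -> Prop, ~ I2 B ->
    exists A : X1 -> Prop, ~ I1 A /\ card_le {x : X1 | A x} {y : X2 | B y}.

(** (lam)^{<kappa} <= non(I), for kappa = (Kt, ltK):
    lam^alpha <= non(I) for every ordinal alpha < kappa *)
Definition ltpow_le_non (Lam : Type) {Kt : Type} (ltK : Kt -> Kt -> Prop)
  {X : Type} (I : (X -> Prop) -> Prop) : Prop :=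
  forall a : Kt, card_le_non ({b : Kt | ltK b a} -> Lam) I.

(** cf([M]^K) <= non(I): for each B not in I there is a family of at most |B|
    subsets of M, each of size <= |K|, covering every subset of M of size <= |K| *)
Definition cf_bracket_le_non (M K : Type) {X : Type} (I : (X -> Prop) -> Prop)
  : Prop :=
  forall B : X -> Prop, ~ I B ->
    exists g : {x : X | B x} -> M -> Prop,
      (forall b, card_le {m : M | g b m} K) /\
      forall S : M -> Prop, card_le {m : M | S m} K ->
        exists b, forall m, S m -> g b m.

Arguments box_base : clear implicits.
Arguments bd_base : clear implicits.

(* Main.v *)
(** A nonmeagre set is dense in some basic open set.  This gives (1), since a
    small condition has as many pairwise incompatible small extensions as there
    are functions on a fresh set of coordinates.  For (2), each comparison of
    spaces is induced by a map [f |-> p o f o i] with [i] injective and [p]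
    surjective, along which nowhere dense sets pull back to nowhere dense sets;
    in the bounded case [i] is a cofinal sequence of length [K].  For (3), a
    point [f] is sent to a set of [K] elements of [M] in such a way that each
    [m] belongs to the set of a generic [f]: the range of [f] on the space of
    functions [K -> M], and the values coded by [f] along a cofinal sequence of
    segments of [M] on the space of functions [M -> bool]. *)
From Stdlib Require Import Classical ClassicalEpsilon FunctionalExtensionality.
From Stdlib Require Import Arith Lia Wellfounded.
Require Import Defs.

(** * Choice, well-founded recursion and comparison of cardinalities *)

Lemma sig_eq (A : Type) (P : A -> Prop) (x y : {a | P a}) :
  proj1_sig x = proj1_sig y -> x = y.
Proof.
  destruct x as [x px], y as [y py]; simpl; intros ->.
  f_equal; apply proof_irrelevance.
Qed.

Lemma dep_choice (A : Type) (B : A -> Type) (R : forall x, B x -> Prop) :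
  (forall x, exists y, R x y) -> exists f : forall x, B x, forall x, R x (f x).
Proof.
  intros H.
  exists (fun x => proj1_sig (constructive_indefinite_description _ (H x))).
  intros x; exact (proj2_sig (constructive_indefinite_description _ (H x))).
Qed.

(** Recursion with a free choice at each stage, [P x g t] saying that [t] is an admissible value at
    [x] after the earlier values [g]. Choosing the response [h x g] beforehand turns it into
    ordinary well-founded recursion. *)
Lemma wf_choice_rec (W T : Type) (R : W -> W -> Prop)
  (P : forall x, ({y | R y x} -> T) -> T -> Prop) :
  well_founded R -> (forall x g, exists t, P x g t) ->
  exists f : W -> T, forall x, P x (fun y => f (proj1_sig y)) (f x).
Proof.
  intros wf H.
  destruct (dep_choice _ _ (fun x (h : ({y | R y x} -> T) -> T) =>
    forall g, P x g (h g))) as [h Hh].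
  { intros x. destruct (dep_choice _ _ _ (H x)) as [h Hh]; eauto. }
  pose (F := fun (x : W) (rec : forall y, R y x -> T) =>
    h x (fun y => rec (proj1_sig y) (proj2_sig y))).
  exists (Fix wf (fun _ => T) F); intros x.
  rewrite Fix_eq; [apply Hh|].
  clear; intros x f g E; unfold F; f_equal.
  apply functional_extensionality; intros [y hy]; apply E.
Qed.

Lemma card_le_trans (A B C : Type) : card_le A B -> card_le B C -> card_le A C.
Proof. intros [f Hf] [g Hg]; exists (fun x => g (f x)); auto. Qed.

Lemma card_le_rel (A B : Type) (R : A -> B -> Prop) :
  (forall x, exists y, R x y) ->
  (forall x x' y, R x y -> R x' y -> x = x') -> card_le A B.
Proof.
  intros H1 H2. destruct (dep_choice _ _ _ H1) as [f Hf].
  exists f; intros x y E; apply (H2 x y (f x)); [auto|rewrite E; auto].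
Qed.

Lemma card_le_sig (A : Type) (P : A -> Prop) : card_le {x | P x} A.
Proof. exists (@proj1_sig _ _); intros x y; apply sig_eq. Qed.

Lemma card_le_sub (A : Type) (P Q : A -> Prop) :
  (forall x, P x -> Q x) -> card_le {x | P x} {x | Q x}.
Proof.
  intros H. exists (fun x => exist _ (proj1_sig x) (H _ (proj2_sig x))).
  intros x y E; apply sig_eq. exact (f_equal (@proj1_sig _ _) E).
Qed.

Lemma card_le_inverse_image (A B : Type) (f : A -> B) (P : B -> Prop) :
  (forall x y, f x = f y -> x = y) -> card_le {x | P (f x)} {y | P y}.
Proof.
  intros Hf.
  exists (fun x => exist P (f (proj1_sig x)) (proj2_sig x)).
  intros x y E; apply sig_eq, Hf. exact (f_equal (@proj1_sig _ _) E).
Qed.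

Lemma card_le_image (A B : Type) (f : A -> B) (P : A -> Prop) :
  card_le {y | exists x, P x /\ y = f x} {x | P x}.
Proof.
  apply (card_le_rel _ _ (fun y x => proj1_sig y = f (proj1_sig x))).
  - intros [y [x [px e]]]; exists (exist _ x px); exact e.
  - intros y y' x e e'; apply sig_eq; congruence.
Qed.

Lemma card_le_range (A B : Type) (f : A -> B) : card_le {y | exists x, y = f x} A.
Proof.
  apply (card_le_rel _ _ (fun y x => proj1_sig y = f x)).
  - intros [y [x e]]; exists x; exact e.
  - intros y y' x e e'; apply sig_eq; congruence.
Qed.

Lemma card_le_prod (A B C D : Type) :
  card_le A B -> card_le C D -> card_le (A * C) (B * D).
Proof.
  intros [f Hf] [g Hg]; exists (fun p => (f (fst p), g (snd p))).
  intros [a c] [a' c'] E; injection E; simpl; intros; f_equal; auto.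
Qed.

Lemma card_le_square_transport (A B : Type) :
  card_le A B -> card_le B A -> card_le (B * B) B -> card_le (A * A) A.
Proof.
  intros H1 H2 H3.
  eapply card_le_trans; [apply card_le_prod; exact H1|].
  eapply card_le_trans; eauto.
Qed.

(** Send each [x] to a value not taken earlier. One is left, since otherwise choosing preimages
    would embed [T] in the segment below [x]. *)
Lemma card_le_of_small_segments (W T : Type) (R : W -> W -> Prop) :
  well_founded R -> (forall x y, R x y \/ x = y \/ R y x) ->
  (forall x, ~ card_le T {y | R y x}) -> card_le W T.
Proof.
  intros wf tot small.
  destruct (wf_choice_rec W T R (fun x g t => forall y, g y <> t) wf) as [f Hf].
  - intros x g. apply NNPP; intros N. apply (small x).
    apply (card_le_rel _ _ (fun t y => g y = t)).
    + intros t; apply NNPP; intros N'; apply N; exists t; intros y E.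
      apply N'; eauto.
    + intros; congruence.
  - exists f; intros x y E.
    destruct (tot x y) as [h|[h|h]]; auto; exfalso.
    + apply (Hf y (exist _ x h)); exact E.
    + apply (Hf x (exist _ y h)); symmetry; exact E.
Qed.

(** * Infinite types: one extra point, and products *)

(** Hilbert's hotel: [None] goes to [h 0], the sequence [h] is shifted by one, and all other points
    stay fixed. *)
Lemma card_le_option (A : Type) : infinite_type A -> card_le (option A) A.
Proof.
  intros [h Hh].
  apply (card_le_rel _ _ (fun o a => match o with
    | None => a = h 0
    | Some x => (exists n, x = h n /\ a = h (S n)) \/
                ((forall n, x <> h n) /\ a = x) end)).
  - intros [x|]; [|eauto].
    destruct (classic (exists n, x = h n)) as [[n e]|N]; [eauto|].
    exists x; right; split; auto. intros n e; apply N; eauto.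
  - intros [x|] [x'|] a; auto.
    + intros [[n [-> ->]]|[H ->]] [[n' [-> e]]|[H' e']].
      * apply Hh in e. congruence.
      * exfalso; apply (H' (S n)); congruence.
      * exfalso; apply (H (S n')); congruence.
      * congruence.
    + intros [[n [-> ->]]|[H ->]] e; exfalso.
      * apply Hh in e; discriminate.
      * exact (H _ e).
    + intros e [[n [-> e']]|[H e']]; exfalso.
      * rewrite e in e'; apply Hh in e'; discriminate.
      * apply (H 0); congruence.
Qed.

(** An injective sequence takes the value [None] at most once, so some tail of it lies in [A]. *)
Lemma infinite_option_inv (A : Type) : infinite_type (option A) -> infinite_type A.
Proof.
  intros [h Hh].
  assert (exists k, forall n, h (k + n) <> None) as [k Hk].
  { destruct (classic (exists k, h k = None)) as [[k e]|N].
    - exists (S k); intros n e'. rewrite <- e in e'. apply Hh in e'; lia.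
    - exists 0; intros n e; apply N; eauto. }
  apply (card_le_rel _ _ (fun n a => h (k + n) = Some a)).
  - intros n. specialize (Hk n). destruct (h (k + n)) as [a|]; [eauto|tauto].
  - intros n n' a e e'. rewrite <- e' in e. apply Hh in e; lia.
Qed.

Lemma iterate_choice (Q : nat -> nat -> Prop) :
  (forall N, exists N', N < N' /\ Q N N') ->
  exists k : nat -> nat, (forall i j, i < j -> k i < k j) /\
    forall i, Q (k i) (k (S i)).
Proof.
  intros H. destruct (dep_choice _ _ _ H) as [nx Hnx].
  exists (fun i => Nat.iter i nx 0); split; [|intros i; apply Hnx].
  intros i j; induction j as [|j IH]; [lia|intros hij].
  destruct (Hnx (Nat.iter j nx 0)) as [h _]; simpl.
  destruct (Nat.eq_dec i j) as [->|]; [exact h|].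
  assert (i < j) by lia. specialize (IH H0); lia.
Qed.

(** If some first coordinate recurs for arbitrarily large indices, the second coordinates at those
    indices are distinct. Otherwise each first coordinate eventually disappears, and a subsequence
    has distinct first coordinates. *)
Lemma infinite_prod_inv (A B : Type) :
  infinite_type (A * B) -> infinite_type A \/ infinite_type B.
Proof.
  intros [h Hh].
  destruct (classic (exists a, forall N, exists n, N < n /\ fst (h n) = a))
    as [[a Ha]|N].
  - right. destruct (iterate_choice (fun _ n => fst (h n) = a) Ha) as [k [Hk Hq]].
    exists (fun i => snd (h (k (S i)))); intros i j e.
    assert (E : h (k (S i)) = h (k (S j))).
    { rewrite (surjective_pairing (h (k (S i)))), (surjective_pairing (h (k (S j)))).
      rewrite !Hq, e; reflexivity. }
    apply Hh in E.
    destruct (Nat.lt_total i j) as [l|[l|l]]; auto; exfalso;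
      assert (l' := Hk (S _) (S _) (proj1 (Nat.succ_lt_mono _ _) l)); lia.
  - left.
    destruct (iterate_choice (fun N N' => forall n, N' <= n -> fst (h n) <> fst (h N)))
      as [k [Hk Hq]].
    { intros N0. apply NNPP; intros N1. apply N. exists (fst (h N0)).
      intros N2. apply NNPP; intros N3. apply N1. exists (S (N0 + N2)).
      split; [lia|]. intros n hn e; apply N3; exists n; split; [lia|auto]. }
    assert (Hne : forall i j, i < j -> fst (h (k j)) <> fst (h (k i))).
    { intros i j l. apply (Hq i).
      destruct (Nat.eq_dec (S i) j) as [->|]; [lia|].
      assert (S i < j) by lia. specialize (Hk _ _ H); lia. }
    exists (fun i => fst (h (k i))); intros i j e.
    destruct (Nat.lt_total i j) as [l|[l|l]]; auto; exfalso.
    + apply (Hne i j l); auto.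
    + apply (Hne j i l); auto.
Qed.

(** * Infinite well-ordered types absorb their squares *)

Section Order.
Context {T : Type} {lt : T -> T -> Prop} (WO : strict_well_order lt).

Lemma restrict_well_order (P : T -> Prop) :
  strict_well_order (fun x y : {x | P x} => lt (proj1_sig x) (proj1_sig y)).
Proof.
  destruct WO as [irr [tr [tot wf]]]. split; [|split; [|split]].
  - intros x; apply irr.
  - intros x y z; apply tr.
  - intros x y. destruct (tot (proj1_sig x) (proj1_sig y)) as [h|[h|h]]; auto.
    right; left; apply sig_eq; auto.
  - apply (wf_inverse_image _ _ lt (@proj1_sig T P) wf).
Qed.

Lemma segment_bound (a b : T) :
  exists c, (forall x, lt x a -> lt x c) /\ (forall x, lt x b -> lt x c).
Proof.
  destruct WO as [irr [tr [tot wf]]].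
  destruct (tot a b) as [h|[<-|h]]; [exists b|exists a|exists a]; eauto.
Qed.

Definition larger (p : T * T) : T :=
  if excluded_middle_informative (lt (fst p) (snd p)) then snd p else fst p.

Lemma larger_upper (p : T * T) :
  (lt (fst p) (larger p) \/ fst p = larger p) /\
  (lt (snd p) (larger p) \/ snd p = larger p).
Proof.
  destruct WO as [irr [tr [tot wf]]]. unfold larger.
  destruct (excluded_middle_informative _) as [h|h]; auto.
  destruct (tot (fst p) (snd p)) as [h'|[h'|h']]; auto; tauto.
Qed.

(* Gödel's well-ordering of pairs: first by maximum, then lexicographically. *)
Definition goedel (q p : T * T) : Prop :=
  lt (larger q) (larger p) \/
  (larger q = larger p /\
    (lt (fst q) (fst p) \/ (fst q = fst p /\ lt (snd q) (snd p)))).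

Lemma goedel_wf : well_founded goedel.
Proof.
  destruct WO as [irr [tr [tot wf]]].
  assert (H : forall m x y, larger (x, y) = m -> Acc goedel (x, y)).
  { intros m; induction (wf m) as [m _ IHm].
    intros x; induction (wf x) as [x _ IHx].
    intros y; induction (wf y) as [y _ IHy]. intros E.
    constructor; intros [x' y'] [h|[h1 [h|[h2 h]]]]; simpl in *.
    - rewrite E in h; eapply IHm; eauto.
    - apply IHx; congruence.
    - subst x'; apply IHy; congruence. }
  intros [x y]; eapply H; eauto.
Qed.

Lemma goedel_total (p q : T * T) : goedel p q \/ p = q \/ goedel q p.
Proof.
  destruct WO as [irr [tr [tot wf]]]. unfold goedel.
  destruct (tot (larger p) (larger q)) as [h|[h|h]]; auto.
  destruct (tot (fst p) (fst q)) as [h1|[h1|h1]]; auto 6.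
  destruct (tot (snd p) (snd q)) as [h2|[h2|h2]]; auto 7.
  right; left. rewrite (surjective_pairing p), (surjective_pairing q); congruence.
Qed.

(** The inductive step of Hessenberg's theorem: in Gödel's order on the square of [D], every pair
    has too few predecessors to embed [D]. *)
Lemma square_of_initial_segment (D : T -> Prop) :
  (forall x y, D x -> lt y x -> D y) ->
  (forall a, D a -> infinite_type {b | lt b a} ->
     card_le ({b | lt b a} * {b | lt b a}) {b | lt b a}) ->
  infinite_type {x | D x} -> card_le ({x | D x} * {x | D x}) {x | D x}.
Proof.
  intros HD IH inf.
  (* If [D] is no larger than one of its proper segments, the two are equinumerous and the
     hypothesis on that segment transports to [D]. *)
  destruct (classic (exists a, D a /\ card_le {x | D x} {b | lt b a}))
    as [[a [da ha]]|N].
  { apply (card_le_square_transport _ {b | lt b a}); auto.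
    - apply card_le_sub; intros b hb; eapply HD; eauto.
    - apply IH; auto. eapply card_le_trans; eauto. }
  pose (pr := fun p : {x | D x} * {x | D x} =>
    (proj1_sig (fst p), proj1_sig (snd p))).
  apply (card_le_of_small_segments _ _ (fun q p => goedel (pr q) (pr p))).
  { apply (wf_inverse_image _ _ goedel pr goedel_wf). }
  { intros p q. destruct (goedel_total (pr p) (pr q)) as [h|[h|h]]; auto.
    right; left. destruct p as [p1 p2], q as [q1 q2]. injection h; simpl.
    intros; f_equal; apply sig_eq; auto. }
  (* Suppose [D] embeds in the predecessors of [p]. Both coordinates of a predecessor are at most
     [m], so [D] embeds in the square of the segment below [m] with one point added, [None] standing
     for [m] itself. *)
  intros p Hp. set (m := larger (pr p)).
  assert (dm : D m).
  { unfold m, larger. destruct (excluded_middle_informative _); simpl.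
    apply (proj2_sig (snd p)). apply (proj2_sig (fst p)). }
  set (Sg := {b | lt b m}).
  assert (H : card_le {x | D x} (option Sg * option Sg)).
  { eapply card_le_trans; [exact Hp|].
    pose (R := fun (x : T) (o : option Sg) => match o with
      | None => x = m | Some b => x = proj1_sig b end).
    assert (R1 : forall x, lt x m \/ x = m -> exists o, R x o).
    { intros x [h|h]; [exists (Some (exist _ x h))|exists None]; simpl; auto. }
    assert (R2 : forall x x' o, R x o -> R x' o -> x = x').
    { intros x x' [o|]; simpl; congruence. }
    apply (card_le_rel _ _ (fun q o =>
      R (fst (pr (proj1_sig q))) (fst o) /\ R (snd (pr (proj1_sig q))) (snd o))).
    - intros [q hq]; cbn [proj1_sig].
      assert (hle : lt (larger (pr q)) m \/ larger (pr q) = m).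
      { destruct hq as [h|[h _]]; auto. }
      destruct WO as [irr [tr [tot wf]]].
      destruct (larger_upper (pr q)) as [h1 h2].
      destruct (R1 (fst (pr q))) as [o1 ho1].
      { destruct h1 as [h1|h1], hle as [h3|h3]; rewrite ?h1, <- ?h3; eauto. }
      destruct (R1 (snd (pr q))) as [o2 ho2].
      { destruct h2 as [h2|h2], hle as [h3|h3]; rewrite ?h2, <- ?h3; eauto. }
      exists (o1, o2); auto.
    - intros [q hq] [q' hq'] [o1 o2]; cbn [proj1_sig fst snd].
      intros [e1 e2] [e1' e2']. apply sig_eq; cbn [proj1_sig].
      apply (R2 _ _ _ e1) in e1'. apply (R2 _ _ _ e2) in e2'.
      destruct q as [q1 q2], q' as [q1' q2']; unfold pr in *; simpl in *.
      f_equal; apply sig_eq; auto. }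
  (* An infinite segment absorbs the added point and its own square, so [D] would embed in it. A
     finite one cannot hold the infinite [D] in the square of its extension by a point. *)
  destruct (classic (infinite_type Sg)) as [i|ni].
  - apply N; exists m; split; auto.
    eapply card_le_trans; [exact H|].
    eapply card_le_trans; [apply card_le_prod; apply card_le_option; exact i|].
    apply IH; auto.
  - apply ni. apply infinite_option_inv.
    destruct (infinite_prod_inv (option Sg) (option Sg)); auto.
    eapply card_le_trans; eauto.
Qed.

Lemma card_le_square : infinite_type T -> card_le (T * T) T.
Proof.
  intros inf. destruct WO as [irr [tr [tot wf]]].
  assert (IH : forall a, infinite_type {b | lt b a} ->
     card_le ({b | lt b a} * {b | lt b a}) {b | lt b a}).
  { intros a; induction (wf a) as [a _ IH]. apply square_of_initial_segment; eauto. }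
  assert (H : card_le T {x : T | True}).
  { exists (fun x => exist (fun _ => True) x I); intros x y E.
    exact (f_equal (@proj1_sig _ _) E). }
  apply (card_le_square_transport _ {x : T | True}); auto using card_le_sig.
  apply square_of_initial_segment; auto. eapply card_le_trans; eauto.
Qed.

End Order.

(* In an injective image of [T * T], either a whole row lies in [Q], or every
   row meets [P]. *)
Lemma card_le_split (T : Type) (P Q : T -> Prop) :
  card_le (T * T) T -> (forall x, P x \/ Q x) ->
  card_le T {x | P x} \/ card_le T {x | Q x}.
Proof.
  intros [p Hp] H.
  destruct (classic (exists x, forall y, Q (p (x, y)))) as [[x Hx]|N].
  - right. exists (fun y => exist _ (p (x, y)) (Hx y)). intros y y' E.
    apply (f_equal (@proj1_sig _ _)) in E. simpl in E.
    apply Hp in E; congruence.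
  - left. apply (card_le_rel _ _ (fun x z => exists y, proj1_sig z = p (x, y))).
    + intros x. apply NNPP; intros N'. apply N; exists x; intros y.
      destruct (H (p (x, y))) as [h|h]; auto.
      exfalso; apply N'; exists (exist _ _ h); simpl; eauto.
    + intros x x' z [y e] [y' e']. rewrite e in e'. apply Hp in e'; congruence.
Qed.

(** * Small sets of coordinates and the topologies they generate *)

Definition small (L : Type) {D : Type} (dom : D -> Prop) : Prop :=
  ~ card_le L {x | dom x}.

(** Split a copy of [L] inside the union according to [P] and [Q]: one of the two pieces again
    contains a copy of [L]. *)
Lemma small_union (L D : Type) (P Q : D -> Prop) :
  card_le (L * L) L -> small L P -> small L Q -> small L (fun x => P x \/ Q x).
Proof.
  intros sq hP hQ [h Hh].
  assert (Hh' : forall x y, proj1_sig (h x) = proj1_sig (h y) -> x = y).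
  { intros x y e; apply Hh, sig_eq, e. }
  destruct (card_le_split L (fun l => P (proj1_sig (h l)))
    (fun l => Q (proj1_sig (h l))) sq) as [H|H].
  - intros x; apply (proj2_sig (h x)).
  - apply hP. eapply card_le_trans; [exact H|].
    apply (card_le_inverse_image _ _ (fun l => proj1_sig (h l))); auto.
  - apply hQ. eapply card_le_trans; [exact H|].
    apply (card_le_inverse_image _ _ (fun l => proj1_sig (h l))); auto.
Qed.

Lemma small_mono (L D D' : Type) (P : D -> Prop) (Q : D' -> Prop) :
  card_le {x | P x} {x | Q x} -> small L Q -> small L P.
Proof. intros H hQ h; apply hQ; eapply card_le_trans; eauto. Qed.

Lemma small_singleton (L D : Type) (d : D) :
  infinite_type L -> small L (fun x => x = d).
Proof.
  intros [h Hh] [f Hf].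
  assert (E : f (h 0) = f (h 1)).
  { apply sig_eq. rewrite (proj2_sig (f (h 0))), (proj2_sig (f (h 1))); auto. }
  apply Hf, Hh in E; discriminate.
Qed.

(** Common form of the box and bounded topologies, which differ only in the admissible domains [sm];
    the category arguments are then carried out once for both. *)
Definition small_domains {D R : Type} (base : ((D -> R) -> Prop) -> Prop)
  (sm : (D -> Prop) -> Prop) : Prop :=
  forall U, base U <->
    exists dom s, sm dom /\ forall f, U f <-> basic_open dom s f.

Lemma box_small_domains (D R L : Type) :
  small_domains (box_base D R L) (small L).
Proof. intros U; unfold box_base, small; tauto. Qed.

Lemma bd_small_domains (D R : Type) (lt : D -> D -> Prop) :
  small_domains (bd_base D R lt) (fun dom => exists a, forall b, dom b <-> lt b a).
Proof.
  intros U; split.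
  - intros [a [s H]]; exists (fun b => lt b a), s; split; auto.
    exists a; tauto.
  - intros [dom [s [[a Ha] H]]]; exists a, s; intros f; rewrite H.
    unfold basic_open; split; intros h x hx; apply h, Ha, hx.
Qed.

(** * Nowhere dense and nonmeagre sets in terms of extending conditions *)

Section Baire.
Context {D R : Type} {base : ((D -> R) -> Prop) -> Prop}
  {sm : (D -> Prop) -> Prop} (Hb : small_domains base sm).

Lemma base_basic_open (dom : D -> Prop) (s : D -> R) :
  sm dom -> base (basic_open dom s).
Proof. intros h; apply Hb; exists dom, s; tauto. Qed.

Lemma nowhere_dense_intro (N : (D -> R) -> Prop) :
  (forall dom s, sm dom -> exists dom' s', sm dom' /\
    (forall x, dom x -> dom' x) /\ (forall x, dom x -> s' x = s x) /\
    forall f, basic_open dom' s' f -> ~ N f) ->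
  nowhere_dense base N.
Proof.
  intros H U oU clU x Ux.
  destruct (oU x Ux) as [B [bB [Bx BU]]].
  destruct (proj1 (Hb B) bB) as [dom [s [hdom HB]]].
  destruct (H dom s hdom) as [dom' [s' [hdom' [sub [agree disj]]]]].
  (* The total function [s'] is itself a point of [[s]], hence of [U], and the condition given by
     [s'] on [dom'] is a neighbourhood of it missing [N]. *)
  assert (Us : U s').
  { apply BU, HB. exact agree. }
  destruct (clU s' Us (basic_open dom' s')) as [y [hy Ny]].
  - intros z hz. exists (basic_open dom' s').
    split; [apply base_basic_open, hdom'|auto].
  - intros z hz; reflexivity.
  - exact (disj y hy Ny).
Qed.

(** If no extension of [s] avoids [N], then [[s]] lies in the closure of [N]: a basic neighbourhood
    of a point of [[s]] meets [[s]] in a condition on the union of the two domains. *)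
Lemma nowhere_dense_elim (N : (D -> R) -> Prop) :
  (forall P Q, sm P -> sm Q -> sm (fun x => P x \/ Q x)) ->
  nowhere_dense base N ->
  forall dom s, sm dom -> exists dom' s', sm dom' /\
    (forall x, dom x -> dom' x) /\ (forall x, dom x -> s' x = s x) /\
    forall f, basic_open dom' s' f -> ~ N f.
Proof.
  intros Hu HN dom s hdom. apply NNPP; intros C.
  apply (HN (basic_open dom s)) with (x := s).
  - intros z hz. exists (basic_open dom s).
    split; [apply base_basic_open, hdom|auto].
  - intros x hx U oU Ux. apply NNPP; intros C'. apply C.
    destruct (oU x Ux) as [B [bB [Bx BU]]].
    destruct (proj1 (Hb B) bB) as [dom1 [s1 [hdom1 HB]]].
    exists (fun z => dom z \/ dom1 z), x. split; [auto|].
    split; [auto|]. split; [exact hx|].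
    intros f hf Nf. apply C'. exists f; split; auto. apply BU, HB.
    intros z hz. rewrite (hf z (or_intror hz)). apply HB; auto.
  - intros z hz; reflexivity.
Qed.

Lemma nowhere_dense_sub (N N' : (D -> R) -> Prop) :
  (forall x, N x -> N' x) -> nowhere_dense base N' -> nowhere_dense base N.
Proof.
  intros S H U oU cl. apply (H U oU). intros x Ux V oV Vx.
  destruct (cl x Ux V oV Vx) as [y [Vy Ny]]; eauto.
Qed.

(** Otherwise [A] would be the union of its traces on the sets [N i]. This is how genericity is used
    below. *)
Lemma nonmeagre_escapes (K : Type) (A : (D -> R) -> Prop) (N : K -> (D -> R) -> Prop) :
  ~ meagre K base A -> (forall i, nowhere_dense base (N i)) ->
  exists x, A x /\ forall i, ~ N i x.
Proof.
  intros HA HN. apply NNPP; intros C. apply HA.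
  exists (fun i x => A x /\ N i x); split.
  - intros i; apply (nowhere_dense_sub _ (N i)); [tauto|auto].
  - intros x; split; [|intros [i [h _]]; auto].
    intros Ax. apply NNPP; intros C'. apply C; exists x; split; auto.
    intros i Ni; apply C'; eauto.
Qed.

Lemma nonmeagre_somewhere_dense (K : Type) (A : (D -> R) -> Prop) :
  inhabited K -> ~ meagre K base A ->
  exists dom s, sm dom /\ forall dom' s', sm dom' ->
    (forall x, dom x -> dom' x) -> (forall x, dom x -> s' x = s x) ->
    exists f, A f /\ basic_open dom' s' f.
Proof.
  intros [k] HA. apply NNPP; intros C.
  destruct (nonmeagre_escapes K A (fun _ => A) HA) as [x [Ax Nx]].
  { intros _. apply nowhere_dense_intro. intros dom s hdom.
    apply NNPP; intros C'. apply C; exists dom, s; split; auto.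
    intros dom' s' h1 h2 h3. apply NNPP; intros C''. apply C'.
    exists dom', s'; repeat (split; auto). intros f hf Af; apply C''; eauto. }
  exact (Nx k Ax).
Qed.

(* A nonmeagre set is dense in some [s], and the extensions of [s] by
   functions on a fresh copy of [E] are pairwise incompatible. *)
Lemma card_le_non_of_extensions (K E : Type) :
  inhabited K ->
  (forall dom, sm dom -> exists (e : E -> D) dom', sm dom' /\
    (forall x y, e x = e y -> x = y) /\ (forall x, ~ dom (e x)) /\
    (forall x, dom x -> dom' x) /\ (forall x, dom' (e x))) ->
  card_le_non (E -> R) (meagre K base).
Proof.
  intros hK He A HA.
  destruct (nonmeagre_somewhere_dense K A hK HA) as [dom [s [hdom H]]].
  destruct (He dom hdom) as [e [dom' [hdom' [einj [efresh [sub edom]]]]]].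
  apply (card_le_rel _ _ (fun u f => forall x, proj1_sig f (e x) = u x)).
  - intros u.
    destruct (dep_choice _ _ (fun d r => (dom d -> r = s d) /\
      (forall x, d = e x -> r = u x))) as [t Ht].
    { intros d. destruct (classic (exists x, d = e x)) as [[x ->]|N].
      - exists (u x); split; [intros h; exfalso; exact (efresh _ h)|].
        intros y h; apply einj in h; congruence.
      - exists (s d); split; auto. intros x h; exfalso; eauto. }
    destruct (H dom' t hdom' sub) as [f [Af hf]].
    { intros x hx; apply Ht, hx. }
    exists (exist _ f Af); simpl; intros x.
    rewrite (hf _ (edom x)). apply Ht; auto.
  - intros u u' f h h'. apply functional_extensionality; intros x.
    rewrite <- h; auto.
Qed.

(** A set [S] of size at most [K] gives at most [K] nowhere dense sets, one for each [m] in [S]. A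
    point [f] of [B] outside all of them satisfies [S] included in [g f]. *)
Lemma cf_bracket_le_non_of_dense (K M : Type) (g : (D -> R) -> M -> Prop) :
  inhabited K ->
  (forall f, card_le {m | g f m} K) ->
  (forall m, nowhere_dense base (fun f => ~ g f m)) ->
  cf_bracket_le_non M K (meagre K base).
Proof.
  intros [k0] Hg Hd B HB. exists (fun f => g (proj1_sig f)); split; [auto|].
  intros S [j Hj].
  destruct (nonmeagre_escapes K B
    (fun k f => exists m, j m = k /\ ~ g f (proj1_sig m)) HB) as [f [Bf Nf]].
  - intros k. destruct (classic (exists m, j m = k)) as [[m e]|N].
    + apply (nowhere_dense_sub _ (fun f => ~ g f (proj1_sig m))); auto.
      intros f [m' [e' h]]. assert (m' = m) by (apply Hj; congruence).
      congruence.
    (* For an index [k] outside the range of [j] the set is empty. *)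
    + intros U oU cl x Ux.
      destruct (cl x Ux U oU Ux) as [y [_ [m [e _]]]]; eauto.
  - exists (exist _ f Bf); intros m Sm. apply NNPP; intros h.
    apply (Nf (j (exist _ m Sm))). eauto.
Qed.

End Baire.

(* [f |-> p o f o i] pulls nowhere dense sets back to nowhere dense sets. *)
Lemma non_le_of_projection (K D1 R1 D2 R2 : Type)
  (base1 : ((D1 -> R1) -> Prop) -> Prop) (base2 : ((D2 -> R2) -> Prop) -> Prop)
  (sm1 : (D1 -> Prop) -> Prop) (sm2 : (D2 -> Prop) -> Prop)
  (i : D1 -> D2) (p : R2 -> R1) :
  small_domains base1 sm1 -> small_domains base2 sm2 ->
  (forall P Q, sm1 P -> sm1 Q -> sm1 (fun x => P x \/ Q x)) ->
  (forall x y, i x = i y -> x = y) -> (forall r, exists r', p r' = r) ->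
  (forall dom, sm2 dom -> sm1 (fun x => dom (i x))) ->
  (forall dom dom1, sm2 dom -> sm1 dom1 -> exists dom', sm2 dom' /\
    (forall x, dom x -> dom' x) /\ (forall x, dom1 x -> dom' (i x))) ->
  non_le (meagre K base1) (meagre K base2).
Proof.
  intros Hb1 Hb2 Hu iinj psurj Hpre Hext B HB.
  pose (phi := fun (f : D2 -> R2) x => p (f (i x))).
  exists (fun f1 => exists f, B f /\ f1 = phi f); split; [|apply card_le_image].
  intros [N [HN HNA]].
  destruct (nonmeagre_escapes K B (fun k f => N k (phi f)) HB) as [f [Bf Nf]].
  - intros k. apply (nowhere_dense_intro Hb2). intros dom s hdom.
    destruct (nowhere_dense_elim Hb1 (N k) Hu (HN k) (fun x => dom (i x)) (phi s)
      (Hpre dom hdom)) as [dom1 [s1 [hdom1 [sub [agree disj]]]]].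
    destruct (Hext dom dom1 hdom hdom1) as [dom' [hdom' [sub1 sub2]]].
    (* The condition [t] keeps [s] on [dom] and lifts [s1] through [p] at the other points of the
       range of [i]. The two demands do not clash, as [s1] agrees with [phi s] on the preimage of
       [dom]. *)
    destruct (dep_choice _ _ (fun y r => (dom y -> r = s y) /\
      (forall x, y = i x -> ~ dom y -> p r = s1 x))) as [t Ht].
    { intros y. destruct (classic (dom y)) as [h|h].
      { exists (s y); split; auto; tauto. }
      destruct (classic (exists x, y = i x)) as [[x ->]|h'].
      - destruct (psurj (s1 x)) as [r hr]. exists r; split; [tauto|].
        intros x' e _. apply iinj in e; congruence.
      - exists (s y); split; auto. intros x e; exfalso; eauto. }
    exists dom', t. split; [auto|]. split; [auto|].
    split; [intros x hx; apply Ht, hx|].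
    intros f hf. apply disj. intros x hx. unfold phi. rewrite (hf _ (sub2 x hx)).
    destruct (classic (dom (i x))) as [h|h].
    + rewrite (proj1 (Ht _) h). symmetry; apply (agree x h).
    + apply (Ht (i x)); auto.
  - destruct (proj1 (HNA (phi f))) as [k hk]; eauto. exact (Nf k hk).
Qed.

(** * Consequences for box topologies *)

Lemma box_non_le (K L D1 R1 D2 R2 : Type) (i : D1 -> D2) (p : R2 -> R1) :
  card_le (L * L) L ->
  (forall x y, i x = i y -> x = y) -> (forall r, exists r', p r' = r) ->
  non_le (meagre K (box_base D1 R1 L)) (meagre K (box_base D2 R2 L)).
Proof.
  intros sq iinj psurj.
  apply (non_le_of_projection K _ _ _ _ _ _ _ _ i p
    (box_small_domains _ _ _) (box_small_domains _ _ _)); auto.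
  - intros P Q; apply small_union, sq.
  - intros dom; apply small_mono, card_le_inverse_image, iinj.
  - intros dom dom1 h h1.
    exists (fun y => dom y \/ exists x, dom1 x /\ y = i x); split; [|split; eauto].
    apply small_union; auto.
    apply (small_mono _ _ _ _ dom1); auto using card_le_image.
Qed.

(** The complement of a small [dom] in [L] contains a copy of [L], hence one of [E]; adding it keeps
    the domain small because [L] does not embed in [E]. *)
Lemma box_power_le_non (K L E R : Type) :
  inhabited K -> card_le (L * L) L -> card_le E L -> ~ card_le L E ->
  card_le_non (E -> R) (meagre K (box_base L R L)).
Proof.
  intros hK sq [h Hh] nEL.
  apply (card_le_non_of_extensions (box_small_domains L R L)); auto.
  intros dom hdom.
  destruct (card_le_split L dom (fun x => ~ dom x) sq) as [H|[e He]].
  { intros x; apply classic. }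
  { exfalso; auto. }
  exists (fun x => proj1_sig (e (h x))),
    (fun y => dom y \/ exists x, y = proj1_sig (e (h x))).
  split; [|split; [|split; [|split]]]; eauto.
  - apply small_union; auto. intros h'; apply nEL.
    eapply card_le_trans; [exact h'|]. apply card_le_range.
  - intros x y E'. apply Hh, He, sig_eq, E'.
  - intros x; apply (proj2_sig (e (h x))).
Qed.

(** A small condition leaves some coordinate [k] undecided, and the value [m] can be prescribed
    there. *)
Lemma box_range_dense (D R L : Type) (m : R) :
  infinite_type L -> card_le (L * L) L -> card_le L D ->
  nowhere_dense (box_base D R L) (fun f => ~ exists x, m = f x).
Proof.
  intros inf sq LD. apply (nowhere_dense_intro (box_small_domains D R L)).
  intros dom s hdom.
  assert (exists k, ~ dom k) as [k hk].
  { apply not_all_ex_not; intros H. apply hdom.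
    eapply card_le_trans; [exact LD|].
    exists (fun x => exist _ x (H x)); intros x y E.
    exact (f_equal (@proj1_sig _ _) E). }
  destruct (dep_choice _ _ (fun d r => (dom d -> r = s d) /\ (d = k -> r = m)))
    as [t Ht].
  { intros d. destruct (classic (d = k)) as [->|h]; [exists m|exists (s d)]; tauto. }
  exists (fun x => dom x \/ x = k), t.
  split; [apply small_union; auto using small_singleton|].
  split; [auto|]. split; [intros x; apply Ht|].
  intros f hf h; apply h. exists k. rewrite (hf k (or_intror eq_refl)).
  symmetry; apply (Ht k); auto.
Qed.

(** * Segments and cofinal sequences of the singular cardinal *)

Section Singular.
Context {K M : Type} {ltK : K -> K -> Prop} {ltM : M -> M -> Prop}
  (HK : is_cardinal ltK) (infK : infinite_type K) (HM : is_cardinal ltM)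
  (cfM : cf_is ltM K) (singM : ~ card_le M K).

Let sqK : card_le (K * K) K := card_le_square (proj1 HK) infK.

(** If no proper segment of [M] contained a copy of [K], then [M] would embed in [K], against
    singularity. *)
Lemma cof_in_segment : exists a, card_le K {b | ltM b a}.
Proof.
  apply NNPP; intros N. apply singM.
  pose proof HM as [[irr [tr [tot wf]]] _].
  apply (card_le_of_small_segments _ _ ltM); auto.
  intros x h; apply N; eauto.
Qed.

Lemma card_le_cof : card_le K M.
Proof.
  pose proof cof_in_segment as [a Ha].
  eapply card_le_trans; [exact Ha|apply card_le_sig].
Qed.

Lemma infinite_singular : infinite_type M.
Proof. eapply card_le_trans; [exact infK|exact card_le_cof]. Qed.

Let sqM : card_le (M * M) M := card_le_square (proj1 HM) infinite_singular.

Lemma bounded_of_small (S : M -> Prop) : small K S -> exists a, forall b, S b -> ltM b a.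
Proof.
  intros hS. apply NNPP; intros N. apply hS. apply cfM.
  intros a. apply NNPP; intros N'. apply N; exists a; intros b Sb.
  apply NNPP; intros h; eauto.
Qed.

(** By recursion, [c i] is taken above all earlier values and above the [i]-th element of a cofinal
    set; this is possible because fewer than [K] elements are bounded. The last clause makes bounded
    sets of [M] pull back to small sets of indices. *)
Lemma cofinal_sequence : exists c : K -> M,
  (forall x y, c x = c y -> x = y) /\ (forall a, exists i, ltM a (c i)) /\
  (forall a, small K (fun i => ltM (c i) a)).
Proof.
  pose proof HM as [[irrM [trM [totM wfM]]] _].
  pose proof HK as [[irrK [trK [totK wfK]]] cardK].
  pose proof cfM as [[S [cofS [j Hj]]] _].
  pose proof infinite_singular as [h _].
  (* [e] enumerates the cofinal set [S] along [K], with the arbitrary value [h 0] at indices outside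
     the range of [j]. *)
  destruct (dep_choice _ _ (fun k m => forall x, j x = k -> m = proj1_sig x))
    as [e He].
  { intros k. destruct (classic (exists x, j x = k)) as [[x Hx]|N].
    - exists (proj1_sig x); intros y Hy. f_equal; apply Hj; congruence.
    - exists (h 0); intros x Hx; exfalso; eauto. }
  destruct (wf_choice_rec K M ltK
    (fun i g t => (forall y, ltM (g y) t) /\ ltM (e i) t) wfK) as [c Hc].
  { intros i g.
    destruct (bounded_of_small (fun m => (exists y, m = g y) \/ m = e i)) as [t Ht].
    - apply small_union; auto using small_singleton.
      intros h'. apply (cardK i). eapply card_le_trans; [exact h'|].
      apply card_le_range.
    - exists t; split; [intros y|]; apply Ht; eauto. }
  assert (mono : forall x y, ltK x y -> ltM (c x) (c y)).
  { intros x y l. exact (proj1 (Hc y) (exist _ x l)). }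
  assert (cof : forall a, exists i, ltM a (c i)).
  { intros a. destruct (cofS a) as [b [Sb nb]].
    set (k := j (exist _ b Sb)). exists k.
    assert (E : e k = b) by (apply (He k (exist _ b Sb)); reflexivity).
    destruct (Hc k) as [_ l]. rewrite E in l.
    destruct (totM a b) as [h'|[h'|h']]; [eauto|congruence|tauto]. }
  exists c; split; [|split; auto].
  - intros x y E. destruct (totK x y) as [l|[l|l]]; auto;
      apply mono in l; rewrite E in l; exfalso; eapply irrM; eauto.
  - intros a. destruct (cof a) as [k Hk]. intros hle. apply (cardK k).
    eapply card_le_trans; [exact hle|]. apply card_le_sub. intros i hi.
    destruct (totK i k) as [l|[->|l]]; auto; exfalso.
    + apply (irrM a); eauto.
    + apply (irrM a). apply mono in l. eauto.
Qed.

(* If every proper segment embedded in [dom], then [M], a union of [K] of them,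
   would embed in [K * dom], hence in [dom]. *)
Lemma segment_not_le_small (dom : M -> Prop) :
  small M dom -> exists a, ~ card_le {b | ltM b a} {x | dom x}.
Proof.
  intros hdom. apply not_all_ex_not; intros H. apply hdom.
  pose proof cof_in_segment as [a Ha].
  assert (Kd : card_le K {x | dom x}) by (eapply card_le_trans; [exact Ha|auto]).
  pose proof cofinal_sequence as [c [_ [cof _]]].
  assert (sq : card_le ({x | dom x} * {x | dom x}) {x | dom x}).
  { apply (card_le_square (restrict_well_order (proj1 HM) dom)).
    eapply card_le_trans; eauto. }
  apply (card_le_trans _ (K * {x | dom x})).
  (* An element [m] is coded by some [i] with [m] below [c i], together with its image under the
     embedding of that segment in [dom]. *)
  - destruct (dep_choice _ _ _ (fun i => H (c i))) as [h Hh].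
    apply (card_le_rel _ _ (fun m p =>
      exists l : ltM m (c (fst p)), snd p = h (fst p) (exist _ m l))).
    + intros m. destruct (cof m) as [i l]. exists (i, h i (exist _ m l)); simpl; eauto.
    + intros m m' [i d] [l e] [l' e']; simpl in *. rewrite e in e'.
      apply Hh in e'. exact (f_equal (@proj1_sig _ _) e').
  - eapply card_le_trans; [|exact sq]. apply card_le_prod; auto.
    exists (fun x => x); auto.
Qed.

(** The last clause covers all longer segments as well, so that [a] may afterwards be replaced by a
    larger term of the cofinal sequence. *)
Lemma large_segment (dom : M -> Prop) (a0 : M) :
  small M dom -> exists a, infinite_type {b | ltM b a} /\
    (forall x, ltM x a0 -> ltM x a) /\
    forall a', (forall x, ltM x a -> ltM x a') ->
    ~ card_le {b | ltM b a'} {x | dom x}.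
Proof.
  intros hdom. destruct (segment_not_le_small dom hdom) as [a2 H2].
  pose proof cof_in_segment as [a3 H3].
  destruct (segment_bound (proj1 HM) a2 a3) as [v [v2 v3]].
  destruct (segment_bound (proj1 HM) a0 v) as [w [w0 wv]].
  exists w; repeat split; auto.
  - eapply card_le_trans; [exact infK|]. eapply card_le_trans; [exact H3|].
    apply card_le_sub; auto.
  - intros a' h h'. apply H2. eapply card_le_trans; [|exact h'].
    apply card_le_sub; auto.
Qed.

Lemma square_segment (a : M) : infinite_type {b | ltM b a} ->
  card_le ({b | ltM b a} * {b | ltM b a}) {b | ltM b a}.
Proof. apply (card_le_square (restrict_well_order (proj1 HM) _)). Qed.

Lemma small_segment (a : M) : small M (fun b => ltM b a).
Proof. apply HM. Qed.

(** * The bounded topology on functions from [M] *)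

(** The fresh coordinates are found between two bounds: the segment below [v] does not embed in the
    one below [u], so the part of it outside the latter holds a copy of the whole, in particular of
    the segment below [a]. *)
Lemma bd_power_le_non (R : Type) (a : M) :
  card_le_non ({b | ltM b a} -> R) (meagre K (bd_base M R ltM)).
Proof.
  pose proof infK as [k _].
  apply (card_le_non_of_extensions (bd_small_domains M R ltM)).
  { exact (inhabits (k 0)). }
  intros dom [a0 Ha0].
  destruct (segment_bound (proj1 HM) a a0) as [u [ua ua0]].
  destruct (large_segment (fun b => ltM b u) u (small_segment u))
    as [v [infv [vu Hv]]].
  destruct (card_le_split {b | ltM b v} (fun b => ltM (proj1_sig b) u)
    (fun b => ~ ltM (proj1_sig b) u) (square_segment v infv)) as [H|[e He]].
  { intros x; apply classic. }
  { exfalso. apply (Hv v); auto. eapply card_le_trans; [exact H|].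
    apply (card_le_inverse_image _ _ (@proj1_sig _ _) (fun b => ltM b u)).
    intros x y; apply sig_eq. }
  exists (fun x => proj1_sig (proj1_sig (e (exist _ (proj1_sig x)
    (vu _ (ua _ (proj2_sig x))))))), (fun b => ltM b v).
  split; [exists v; tauto|]. split; [|split; [|split]].
  - intros x y E. apply sig_eq, sig_eq, He in E. apply sig_eq.
    exact (f_equal (@proj1_sig _ _) E).
  - intros x hx. apply (proj2_sig (e (exist _ (proj1_sig x)
      (vu _ (ua _ (proj2_sig x)))))). apply ua0, Ha0, hx.
  - intros x hx. apply vu, ua0, Ha0, hx.
  - intros x. exact (proj2_sig (proj1_sig (e _))).
Qed.

(** Restriction along [c]: bounded domains pull back to small ones, and the image of a small set of
    indices is bounded. *)
Lemma bd_non_le (R : Type) :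
  non_le (meagre K (box_base K R K)) (meagre K (bd_base M R ltM)).
Proof.
  pose proof cofinal_sequence as [c [cinj [cof csmall]]].
  apply (non_le_of_projection K _ _ _ _ _ _ _ _ c (fun r => r)
    (box_small_domains _ _ _) (bd_small_domains _ _ _)); eauto.
  - intros P Q; apply small_union, sqK.
  - intros dom [a Ha]. apply (small_mono _ _ _ _ (fun i => ltM (c i) a)); auto.
    apply card_le_sub; intros x; apply Ha.
  - intros dom dom1 [a Ha] h1.
    destruct (bounded_of_small (fun y => exists x, dom1 x /\ y = c x)) as [a1 Ha1].
    { apply (small_mono _ _ _ _ dom1); auto using card_le_image. }
    destruct (segment_bound (proj1 HM) a a1) as [u [ua ua1]].
    exists (fun b => ltM b u); split; [exists u; tauto|]. split.
    + intros x hx; apply ua, Ha, hx.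
    + intros x hx; apply ua1, Ha1; eauto.
Qed.

(** * Covering small subsets of [M] by coded values *)

(* [f] codes [m < a] when [m] is the only [m' < a] such that [f] takes the
   value [true] at [|a|] many points of the column [{P (m', b) | b < a}].
   A condition of size [< |a|] leaves the coded value free, and all columns
   below [a] together have size [|a| < |M|]. *)
Lemma cf_bracket_le_non_bool :
  cf_bracket_le_non M K (meagre K (box_base M bool M)).
Proof.
  pose proof infK as [k0 _].
  pose proof sqM as [P HP].
  pose proof cofinal_sequence as [c [_ [cof _]]].
  pose (Q := fun (f : M -> bool) a m => ltM m a /\
    card_le {b | ltM b a} {b | ltM b a /\ f (P (m, b)) = true}).
  apply (cf_bracket_le_non_of_dense K M
    (fun f m => exists i, Q f (c i) m /\ forall m', Q f (c i) m' -> m' = m)).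
  { exact (inhabits (k0 0)). }
  { intros f. apply (card_le_rel _ _ (fun m i => Q f (c i) (proj1_sig m) /\
      forall m', Q f (c i) m' -> m' = proj1_sig m)).
    - intros [m hm]; exact hm.
    - intros m m' i [h _] [_ h']. apply sig_eq; auto. }
  intros m. apply (nowhere_dense_intro (box_small_domains M bool M)).
  intros dom s hdom.
  destruct (cof m) as [i0 hi0].
  destruct (large_segment dom (c i0) hdom) as [a1 [inf1 [ha1 H1]]].
  destruct (cof a1) as [i hi]. set (a := c i) in *.
  assert (tr : forall x, ltM x a1 -> ltM x a).
  { intros x l. pose proof HM as [[_ [tr _]] _]; eauto. }
  assert (ma : ltM m a) by auto.
  assert (infa : infinite_type {b | ltM b a}).
  { eapply card_le_trans; [exact inf1|]. apply card_le_sub; auto. }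
  assert (Ha : ~ card_le {b | ltM b a} {x | dom x}) by auto.
  assert (sqa := square_segment a infa).
  (* All columns below [a] lie in the image of the square of the segment, so one small condition can
     decide all of them. *)
  pose (cols := fun x => exists p, (ltM (fst p) a /\ ltM (snd p) a) /\ x = P p).
  (* Outside [dom], [t] is true exactly on column [m]. *)
  destruct (dep_choice _ _ (fun x r => (dom x -> r = s x) /\
    (~ dom x -> (r = true <-> exists b, x = P (m, b))))) as [t Ht].
  { intros x. destruct (classic (dom x)) as [h|h]; [exists (s x); tauto|].
    destruct (classic (exists b, x = P (m, b))) as [h'|h'].
    - exists true; tauto.
    - exists false; split; [tauto|]. intros _; split; [discriminate|tauto]. }
  exists (fun x => dom x \/ cols x), t.
  split; [|split; [auto|split; [intros x hx; apply Ht, hx|]]].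
  { apply small_union; [exact (ex_intro _ P HP)|exact hdom|].
    apply (small_mono _ _ _ _ (fun b => ltM b a)); [|apply small_segment].
    eapply card_le_trans; [apply card_le_image|].
    eapply card_le_trans; [|exact sqa].
    exists (fun p => (exist _ (fst (proj1_sig p)) (proj1 (proj2_sig p)),
                      exist _ (snd (proj1_sig p)) (proj2 (proj2_sig p)))).
    intros [[x y] hp] [[x' y'] hp'] E. apply sig_eq; simpl in *.
    injection E; congruence. }
  intros f hf h; apply h; clear h. exists i.
  assert (fdom : forall x, dom x -> f x = s x).
  { intros x hx. rewrite hf; auto. apply Ht, hx. }
  assert (fcol : forall m' b, ltM m' a -> ltM b a -> ~ dom (P (m', b)) ->
    (f (P (m', b)) = true <-> m' = m)).
  { intros m' b hm' hb nd. rewrite hf; [|right; exists (m', b); auto].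
    rewrite (proj2 (Ht _) nd). split.
    - intros [b' E]. apply HP in E; congruence.
    - intros ->; eauto. }
  assert (Pinj : forall m' b b', P (m', b) = P (m', b') -> b = b').
  { intros m' b b' E; apply HP in E; congruence. }
  split; [split; [exact ma|]|].
  - fold a.
    (* Column [m] cannot have a copy of the segment inside [dom], so it has one outside, where [f]
       is true. *)
    destruct (card_le_split {b | ltM b a} (fun b => dom (P (m, proj1_sig b)))
      (fun b => ~ dom (P (m, proj1_sig b))) sqa) as [H|H].
    { intros x; apply classic. }
    { exfalso; apply Ha. eapply card_le_trans; [exact H|].
      apply (card_le_inverse_image _ _ (fun b => P (m, proj1_sig b)) dom).
      intros x y E; apply sig_eq; eauto. }
    eapply card_le_trans; [exact H|].
    apply (card_le_rel _ _ (fun b b' => proj1_sig (proj1_sig b) = proj1_sig b')).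
    + intros [[b hb] nd]; simpl in nd.
      unshelve eexists (exist _ b _); [|reflexivity].
      split; [exact hb|]. apply fcol; auto.
    + intros x x' b e e'; apply sig_eq, sig_eq; congruence.
  (* In a column [m'] other than [m], [f] is true only at points of [dom], which contains no copy of
     the segment. *)
  - fold a. intros m' [hm' hQ]. apply NNPP; intros ne. apply Ha.
    eapply card_le_trans; [exact hQ|].
    eapply card_le_trans; [|
      apply (card_le_inverse_image _ _ (fun b => P (m', b)) dom); apply Pinj].
    apply card_le_sub. intros b [hb e]. apply NNPP; intros nd.
    apply ne. eapply fcol; eauto.
Qed.

End Singular.

(** * The three groups of inequalities, from the maps between the index sets *)

Theorem mainTheorem11 (K : Type) (ltK : K -> K -> Prop)
  (M : Type) (ltM : M -> M -> Prop)
  (HKcard : is_cardinal ltK) (HKinf : infinite_type K) (HKreg : regular ltK)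
  (HMcard : is_cardinal ltM) (HMcf : cf_is ltM K) (HMsing : ~ card_le M K) :
  let I_KM_k  := meagre K (box_base K M K) in
  let I_M2_m  := meagre K (box_base M bool M) in
  let I_MM_bd := meagre K (bd_base M M ltM) in
  let I_MM_m  := meagre K (box_base M M M) in
  let I_KK_k  := meagre K (box_base K K K) in
  let I_MM_k  := meagre K (box_base M M K) in
  let I_MK_k  := meagre K (box_base M K K) in
  (* (1) *)
  (ltpow_le_non M ltK I_KM_k /\
   ltpow_le_non bool ltM I_M2_m /\
   (ltpow_le_non M ltM I_MM_bd /\ ltpow_le_non M ltM I_MM_m)) /\
  (* (2) *)
  (non_le I_KK_k I_KM_k /\
   non_le I_KM_k I_MM_bd /\
   non_le I_KM_k I_MM_k /\
   non_le I_M2_m I_MM_m /\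
   non_le I_KK_k I_MK_k /\
   non_le I_MK_k I_MM_k) /\
  (* (3) *)
  (cf_bracket_le_non M K I_KM_k /\ cf_bracket_le_non M K I_M2_m).
Proof.
  cbv zeta.
  pose proof (card_le_square (proj1 HKcard) HKinf) as sqK.
  pose proof (card_le_cof HMcard HMsing) as KM.
  pose proof (infinite_singular HKinf HMcard HMsing) as infM.
  pose proof (card_le_square (proj1 HMcard) infM) as sqM.
  assert (hK : inhabited K) by (destruct HKinf as [k _]; exact (inhabits (k 0))).
  destruct KM as [i Hi].
  (* [p] is a left inverse of the injection [i], with an arbitrary value off its range. *)
  assert (exists p : M -> K, forall k, exists m, p m = k) as [p Hp].
  { destruct hK as [k0].
    destruct (dep_choice _ _ (fun m k => forall k', m = i k' -> k = k')) as [p Hp].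
    { intros m. destruct (classic (exists k, m = i k)) as [[k ->]|N].
      - exists k; auto.
      - exists k0; intros k e; exfalso; eauto. }
    exists p; intros k; exists (i k); apply Hp; reflexivity. }
  assert (exists q : M -> bool, forall b, exists m, q m = b) as [q Hq].
  { destruct infM as [h Hh].
    destruct (dep_choice _ _ (fun m b => b = true <-> m = h 0)) as [q Hq].
    { intros m. destruct (classic (m = h 0)); [exists true|exists false];
        split; congruence. }
    exists q; intros [|].
    - exists (h 0); apply Hq; reflexivity.
    - exists (h 1). destruct (q (h 1)) eqn:E; auto.
      apply Hq, Hh in E; discriminate. }
  split; [|split].
  - split; [|split; [|split]].
    + intros a; apply box_power_le_non; auto; [apply card_le_sig|apply HKcard].
    + intros a; apply box_power_le_non; auto; [apply card_le_sig|apply HMcard].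
    + intros a; apply (bd_power_le_non HKcard HKinf HMcard HMcf HMsing).
    + intros a; apply box_power_le_non; auto; [apply card_le_sig|apply HMcard].
  - split; [|split; [|split; [|split; [|split]]]].
    + apply (box_non_le K K _ _ _ _ (fun x => x) p); auto.
    + apply (bd_non_le HKcard HKinf HMcard HMcf HMsing).
    + apply (box_non_le K K _ _ _ _ i (fun x => x)); eauto.
    + apply (box_non_le K M _ _ _ _ (fun x => x) q); auto.
    + apply (box_non_le K K _ _ _ _ i (fun x => x)); eauto.
    + apply (box_non_le K K _ _ _ _ (fun x => x) p); auto.
  - split.
    + apply (cf_bracket_le_non_of_dense K M
        (fun f m => exists x, m = f x)); auto using card_le_range.
      intros m. apply box_range_dense; auto. exists (fun x => x); auto.
    + apply (cf_bracket_le_non_bool HKcard HKinf HMcard HMcf HMsing).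
Qed.
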